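(* Let $\gamma:[0,1]\to[0,1]^2$ be a continuous curve such that $\gamma(0)=(0,0)$, $\gamma(1)=(1,1)$, and $\gamma(t)\in(0,1)^2$ for all $t\in(0,1)$. Then for each $n\in\mathbb{N}$ there exist points $A_0,A_1,\ldots,A_{n+1}$ on $\gamma$ (i.e. in the image $\gamma([0,1])$) such that $A_0=(0,0)$, $A_{n+1}=(1,1)$, all the numbers $\pi_1(\overrightarrow{A_iA_{i+1}})$ and $\pi_2(\overrightarrow{A_iA_{i+1}})$, $i=0,\ldots,n$, are strictly positive, and the two finite sequences $\big(\pi_1(\overrightarrow{A_iA_{i+1}})\big)_{i=0}^{n}$ and $\big(\pi_2(\overrightarrow{A_iA_{i+1}})\big)_{i=0}^{n}$ are the same after a rearrangement (i.e. there is a permutation $\sigma$ of $\{0,\ldots,n\}$ with $\pi_1(\overrightarrow{A_iA_{i+1}})=\pi_2(\overrightarrow{A_{\sigma(i)}A_{\sigma(i)+1}})$ for all $i$).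
   Context: $\pi_1,\pi_2:\mathbb{R}^2\to\mathbb{R}$ denote the projections onto the $x$-axis and the $y$-axis, $\pi_1(a,b)=a$, $\pi_2(a,b)=b$. For points $A,B\in\mathbb{R}^2$, $\overrightarrow{AB}=B-A$. *)

(* Defs.v *)
From Stdlib Require Import Reals.
Open Scope R_scope.

Definition pi1 (P : R * R) : R := fst P.
Definition pi2 (P : R * R) : R := snd P.
Definition vec (A B : R * R) : R * R := (fst B - fst A, snd B - snd A).

(* continuity of gamma : R -> R*R on [0,1] (relative to [0,1]), with the
   Euclidean-equivalent max distance on R^2 *)
Definition continuous_on_01 (g : R -> R * R) : Prop :=
  forall t, 0 <= t <= 1 -> forall eps, 0 < eps -> exists delta, 0 < delta /\
    forall s, 0 <= s <= 1 -> Rabs (s - t) < delta ->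
      Rabs (fst (g s) - fst (g t)) < eps /\ Rabs (snd (g s) - snd (g t)) < eps.

Definition is_perm_upto (n : nat) (sigma : nat -> nat) : Prop :=
  (forall i, (i <= n)%nat -> (sigma i <= n)%nat) /\
  (forall i j, (i <= n)%nat -> (j <= n)%nat -> sigma i = sigma j -> i = j).

(* Main.v *)
Require Import Defs.
From Stdlib Require Import Reals Lra Lia Arith Bool FinFun.
From Stdlib Require Import ClassicalEpsilon IndefiniteDescription.
Open Scope R_scope.

(** If the curve meets the diagonal at points accumulating at the origin, such
    points give chains with [sigma] the identity. Otherwise, up to exchanging the
    coordinates, the curve stays weakly above the diagonal until it returns to it
    at some [(p, p)] with [p > 0]. On that arc look for points with
    [x_(k+1) = y_k + c], where [c = x_1], and [y_n + c = p]: then every horizontal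
    increment is the preceding vertical one, cyclically, and the points increase
    because [x <= y] and [c > 0]. A last square step from [(p, p)] to [(1, 1)]
    finishes the chain.

    Such orbits exist by an intermediate value argument in [c], where [x] need not
    be monotone: one follows a discrete path of approximate orbits from [c = 0] to
    [c = p], extended by one point at a time with a parity argument on sign
    changes in a grid, and then passes to the limit. *)

(** * Sign changes in a grid and their parity *)

(* [d = true] is the edge from [(k, j)] to [(k, S j)], [d = false] the edge from
   [(k, j)] to [(S k, j)]. *)
Definition flipped (s : nat -> nat -> bool) (d : bool) (k j : nat) : bool :=
  if d then xorb (s k j) (s k (S j)) else xorb (s k j) (s (S k) j).

Definition edge_of_square (k j : nat) (d : bool) (k' j' : nat) : Prop :=
  (d = true /\ (k' = k \/ k' = S k) /\ j' = j) \/
  (d = false /\ k' = k /\ (j' = j \/ j' = S j)).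

(** The flipped edges are those crossed by the interface between the two values of [s]. This
    predicate follows, square by square, the pieces of the interface that enter through the side
    [k = 0]. *)
Inductive reached (s : nat -> nat -> bool) (N M : nat) : bool -> nat -> nat -> Prop :=
| reached_start j : (j < M)%nat -> flipped s true 0 j = true -> reached s N M true 0 j
| reached_step k j d k1 j1 d' k2 j2 : (k < N)%nat -> (j < M)%nat ->
    edge_of_square k j d k1 j1 -> edge_of_square k j d' k2 j2 ->
    flipped s d' k2 j2 = true -> reached s N M d k1 j1 -> reached s N M d' k2 j2.

Lemma reached_flipped s N M d k j : reached s N M d k j -> flipped s d k j = true.
Proof. intros H; destruct H; assumption. Qed.

Definition reachedb s N M d k j : bool :=
  if excluded_middle_informative (reached s N M d k j) then true else false.

Lemma reachedb_spec s N M d k j : reachedb s N M d k j = true <-> reached s N M d k j.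
Proof.
  unfold reachedb; destruct excluded_middle_informative; intuition discriminate.
Qed.

Lemma reachedb_not_flipped s N M d k j :
  flipped s d k j = false -> reachedb s N M d k j = false.
Proof.
  intros Hf; apply not_true_is_false; intros Hr.
  apply reachedb_spec, reached_flipped in Hr; congruence.
Qed.

(* A square has an even number of flipped edges, and they are reached all or none. *)
Lemma reachedb_square_even s N M k j : (k < N)%nat -> (j < M)%nat ->
  xorb (xorb (reachedb s N M true k j) (reachedb s N M true (S k) j))
       (xorb (reachedb s N M false k j) (reachedb s N M false k (S j))) = false.
Proof.
  intros Hk Hj.
  destruct (classic (exists d k' j', edge_of_square k j d k' j' /\ reached s N M d k' j'))
    as [(d & k1 & j1 & Hsq & Hr) | Hno].
  - assert (Hall : forall d' k2 j2, edge_of_square k j d' k2 j2 ->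
              reachedb s N M d' k2 j2 = flipped s d' k2 j2).
    { intros d' k2 j2 Hsq'.
      destruct (flipped s d' k2 j2) eqn:Hf.
      - apply reachedb_spec, (reached_step s N M k j d k1 j1 d' k2 j2); assumption.
      - apply reachedb_not_flipped; exact Hf. }
    rewrite !Hall by (unfold edge_of_square; tauto).
    unfold flipped.
    destruct (s k j), (s (S k) j), (s k (S j)), (s (S k) (S j)); reflexivity.
  - assert (Hall : forall d' k2 j2, edge_of_square k j d' k2 j2 ->
              reachedb s N M d' k2 j2 = false).
    { intros d' k2 j2 Hsq'; apply not_true_is_false; intros Hr.
      apply Hno; exists d', k2, j2; split; [exact Hsq' | now apply reachedb_spec]. }
    rewrite !Hall by (unfold edge_of_square; tauto).
    reflexivity.
Qed.

Fixpoint parity (f : nat -> bool) (n : nat) : bool :=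
  match n with O => false | S n => xorb (parity f n) (f n) end.

Lemma parity_true f n : parity f n = true -> exists j, (j < n)%nat /\ f j = true.
Proof.
  induction n as [|n IH]; simpl; [discriminate|].
  destruct (f n) eqn:E; [exists n; split; [lia|exact E]|].
  rewrite xorb_false_r; intros H; destruct (IH H) as (j & Hj & Hf).
  exists j; split; [lia|exact Hf].
Qed.

(** Oddness passes from each row to the next: between two rows the interface cannot escape through
    [j = 0] or [j = M], where [s] is constant. *)
Lemma reached_row_parity s N M k :
  (forall k, (k <= N)%nat -> s k 0%nat = false) ->
  (forall k, (k <= N)%nat -> s k M = true) ->
  (k <= N)%nat -> parity (reachedb s N M true k) M = true.
Proof.
  intros H0 HM; induction k as [|k IH]; intros Hk.
  (* On the starting side every flipped edge is reached, so the count telescopes to the two end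
     values. *)
  - assert (forall j, (j <= M)%nat ->
              parity (reachedb s N M true 0) j = xorb (s 0%nat 0%nat) (s 0%nat j)) as E.
    { induction j as [|j IHj]; intros Hj; simpl; [now rewrite xorb_nilpotent|].
      rewrite IHj by lia.
      assert (reachedb s N M true 0 j = flipped s true 0 j) as ->.
      { destruct (flipped s true 0 j) eqn:Hf.
        - apply reachedb_spec, reached_start; [lia|exact Hf].
        - apply reachedb_not_flipped; exact Hf. }
      unfold flipped.
      destruct (s 0%nat 0%nat), (s 0%nat j), (s 0%nat (S j)); reflexivity. }
    rewrite E, H0, HM by lia; reflexivity.
  (* Adding up the even squares below [j], each inner edge cancels; the edge at height [0] is not
     flipped, so only the one at height [j] remains. *)
  - assert (forall j, (j <= M)%nat ->
              xorb (parity (reachedb s N M true k) j) (parity (reachedb s N M true (S k)) j)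
              = reachedb s N M false k j) as E.
    { induction j as [|j IHj]; intros Hj; simpl.
      - symmetry; apply reachedb_not_flipped; unfold flipped; rewrite !H0 by lia; reflexivity.
      - pose proof (reachedb_square_even s N M k j ltac:(lia) ltac:(lia)) as Hs.
        specialize (IHj ltac:(lia)).
        destruct (parity (reachedb s N M true k) j), (parity (reachedb s N M true (S k)) j),
          (reachedb s N M true k j), (reachedb s N M true (S k) j),
          (reachedb s N M false k j), (reachedb s N M false k (S j));
          simpl in *; congruence. }
    specialize (E M ltac:(lia)).
    rewrite IH in E by lia.
    assert (reachedb s N M false k M = false) as E'.
    { apply reachedb_not_flipped; unfold flipped; rewrite !HM by lia; reflexivity. }
    rewrite E' in E.
    destruct (parity (reachedb s N M true (S k)) M); [reflexivity|discriminate].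
Qed.

Definition near_flip (s : nat -> nat -> bool) (N M k j : nat) : Prop :=
  (k <= N)%nat /\ (j <= M)%nat /\
  (((j < M)%nat /\ s k j <> s k (S j)) \/ ((k < N)%nat /\ s k j <> s (S k) j)).

Lemma xorb_true_neq a b : xorb a b = true -> a <> b.
Proof. destruct a, b; simpl; congruence. Qed.

Definition near_walk (w : nat -> nat * nat) (r : nat) : Prop :=
  (fst (w (S r)) <= S (fst (w r)))%nat /\ (fst (w r) <= S (fst (w (S r))))%nat /\
  (snd (w (S r)) <= S (snd (w r)))%nat /\ (snd (w r) <= S (snd (w (S r))))%nat.

(** The walk unrolls the derivation of [reached], recording the base point of each edge; two edges
    of one square have base points that differ by at most one in each coordinate. *)
Lemma reached_walk s N M d k j :
  reached s N M d k j ->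
  exists (L : nat) (w : nat -> nat * nat),
    fst (w 0%nat) = 0%nat /\ (snd (w 0%nat) < M)%nat /\
    s 0%nat (snd (w 0%nat)) <> s 0%nat (S (snd (w 0%nat))) /\
    w L = (k, j) /\
    (forall r, (r <= L)%nat -> near_flip s N M (fst (w r)) (snd (w r))) /\
    (forall r, (r < L)%nat -> near_walk w r).
Proof.
  intros H; induction H as [j Hj Hf | k j d k1 j1 d' k2 j2 Hk Hj Hs1 Hs2 Hf _ IH].
  - apply xorb_true_neq in Hf.
    exists 0%nat, (fun _ => (0%nat, j)); simpl; repeat split; try lia; try assumption.
    left; split; assumption.
  - destruct IH as (L & w & Hw0 & Hw1 & Hw2 & HwL & Hflip & Hnear).
    exists (S L), (fun r => if (r <=? L)%nat then w r else (k2, j2)).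
    split; [exact Hw0|]; split; [exact Hw1|]; split; [exact Hw2|].
    split; [|split].
    + cbv beta; destruct (Nat.leb_spec (S L) L); [lia|reflexivity].
    + intros r Hr; destruct (Nat.leb_spec r L); [apply Hflip; assumption|].
      simpl; unfold near_flip.
      destruct Hs2 as [(-> & Hk2 & ->) | (-> & -> & Hj2)];
        apply xorb_true_neq in Hf.
      * split; [lia|]; split; [lia|]; left; split; [lia|exact Hf].
      * split; [lia|]; split; [lia|]; right; split; [lia|exact Hf].
    + intros r Hr; unfold near_walk; cbv beta.
      destruct (Nat.leb_spec r L); [|lia].
      destruct (Nat.leb_spec (S r) L); [apply Hnear; lia|].
      assert (r = L) as -> by lia.
      rewrite HwL; simpl.
      destruct Hs1 as [(_ & Hk1 & ->) | (_ & -> & Hj1)];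
        destruct Hs2 as [(_ & Hk2 & ->) | (_ & -> & Hj2)]; lia.
Qed.

(** An odd number of edges is reached at [k = N], hence at least one. This is the discrete form of
    the fact that a set separating bottom from top joins the left side to the right side. *)
Lemma strip_walk (s : nat -> nat -> bool) (N M : nat) :
  (forall k, (k <= N)%nat -> s k 0%nat = false) ->
  (forall k, (k <= N)%nat -> s k M = true) ->
  exists (L : nat) (w : nat -> nat * nat),
    fst (w 0%nat) = 0%nat /\ (snd (w 0%nat) < M)%nat /\
    s 0%nat (snd (w 0%nat)) <> s 0%nat (S (snd (w 0%nat))) /\
    fst (w L) = N /\
    (forall r, (r <= L)%nat -> near_flip s N M (fst (w r)) (snd (w r))) /\
    (forall r, (r < L)%nat -> near_walk w r).
Proof.
  intros H0 HM.
  destruct (parity_true _ _ (reached_row_parity s N M N H0 HM (le_n N))) as (j & Hj & Hr).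
  apply reachedb_spec in Hr.
  destruct (reached_walk s N M true N j Hr) as (L & w & ? & ? & ? & HwL & ? & ?).
  exists L, w; rewrite HwL; simpl; auto 7.
Qed.

(** * Uniform continuity and meshes of an interval *)

Lemma continuity_uniform (f : R -> R) (T : R) : continuity f -> 0 <= T ->
  forall eps, 0 < eps -> exists delta, 0 < delta /\
    forall s t, 0 <= s <= T -> 0 <= t <= T -> Rabs (s - t) <= delta ->
      Rabs (f s - f t) <= eps.
Proof.
  intros Hf HT eps Heps.
  destruct (Heine_cor2 (f := f) (a := 0) (b := T) (fun t _ => Hf t) (mkposreal eps Heps))
    as [[d Hd] H]; simpl in H.
  exists (d / 2); split; [lra|].
  intros s t Hs Ht Hst; left; apply H; try assumption; lra.
Qed.

Lemma Rabs_le_inv a b : Rabs a <= b -> - b <= a <= b.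
Proof. unfold Rabs; destruct Rcase_abs; lra. Qed.

Lemma Rmin_lipschitz a b p : Rabs (Rmin a p - Rmin b p) <= Rabs (a - b).
Proof.
  unfold Rmin; destruct (Rle_dec a p), (Rle_dec b p); unfold Rabs;
    repeat destruct Rcase_abs; lra.
Qed.

Lemma fine_mesh T delta : 0 < T -> 0 < delta ->
  exists M, (0 < M)%nat /\ T / INR M <= delta.
Proof.
  intros HT Hd.
  destruct (INR_archimed (delta) T Hd) as [M HM].
  destruct M as [|M]; [simpl in HM; lra|].
  exists (S M); split; [lia|].
  assert (0 < INR (S M)) by (apply lt_0_INR; lia).
  apply Rmult_le_reg_r with (INR (S M)); [assumption|].
  field_simplify; lra.
Qed.

Lemma mesh_bounds T M j : 0 < T -> (0 < M)%nat -> (j <= M)%nat ->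
  0 <= T * INR j / INR M <= T.
Proof.
  intros HT HM Hj.
  assert (0 < INR M) by (apply lt_0_INR; lia).
  assert (0 <= INR j <= INR M) by (split; [apply pos_INR|apply le_INR; lia]).
  split.
  - apply Rmult_le_pos; [nra|left; apply Rinv_0_lt_compat; assumption].
  - apply Rmult_le_reg_r with (INR M); [assumption|].
    field_simplify; [nra|lra].
Qed.

Lemma mesh_step T M j j' : 0 < T -> (0 < M)%nat -> (j' <= S j)%nat -> (j <= S j')%nat ->
  Rabs (T * INR j' / INR M - T * INR j / INR M) <= T / INR M.
Proof.
  intros HT HM H1 H2.
  assert (0 < INR M) by (apply lt_0_INR; lia).
  replace (T * INR j' / INR M - T * INR j / INR M) with (T / INR M * (INR j' - INR j))
    by (field; lra).
  assert (0 < T / INR M) by (apply Rdiv_lt_0_compat; assumption).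
  apply le_INR in H1, H2; rewrite S_INR in H1, H2.
  rewrite Rabs_mult, (Rabs_right (T / INR M)) by lra.
  assert (Rabs (INR j' - INR j) <= 1) by (apply Rabs_le; lra).
  nra.
Qed.

(** * Paths of approximate orbits *)

(** The shift [c] is [x (q 0)]. Truncating the target at [p] keeps it in the range that [x] covers
    on [[0, T]], so an orbit can always be continued. *)
Definition approx_orbit (x y : R -> R) (T p eps : R) (i : nat) (q : nat -> R) : Prop :=
  (forall k, (k <= i)%nat -> 0 <= q k <= T) /\
  forall k, (k < i)%nat ->
    Rabs (x (q (S k)) - Rmin (y (q k) + x (q 0%nat)) p) <= eps.

(** Since [x] need not be monotone, the next point cannot be chosen continuously in [c]. Instead,
    the grid has the old path of orbits on one axis and a mesh of [[0, T]] for the new point on the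
    other; the walk along the sign changes of the new residual [h] is the new path, which may run
    back and forth along the old one. *)
Lemma approx_orbit_path (x y : R -> R) (T p : R) :
  continuity x -> continuity y -> 0 < T -> 0 < p ->
  x 0 = 0 -> y 0 = 0 -> x T = p ->
  (forall t, 0 <= t <= T -> 0 <= x t /\ 0 <= y t) ->
  forall i eps delta, 0 < eps -> 0 < delta ->
  exists (N : nat) (Q : nat -> nat -> R),
    (forall k, (k <= i)%nat -> Q 0%nat k = 0) /\ Q N 0%nat = T /\
    (forall r, (r <= N)%nat -> approx_orbit x y T p eps i (Q r)) /\
    (forall r k, (r < N)%nat -> (k <= i)%nat -> Rabs (Q (S r) k - Q r k) <= delta).
Proof.
  intros Cx Cy HT Hp x0 y0 xT Hpos i; induction i as [|i IH]; intros eps delta Heps Hdelta.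
  - destruct (fine_mesh T delta HT Hdelta) as (M & HM & HMd).
    assert (0 < INR M) by (apply lt_0_INR; lia).
    exists M, (fun r _ => T * INR r / INR M); split; [|split; [|split]].
    + intros k _; simpl; field; lra.
    + field; lra.
    + intros r Hr; split; [|intros k Hk; lia].
      intros k _; apply mesh_bounds; assumption.
    + intros r k Hr _.
      eapply Rle_trans; [|exact HMd]; apply mesh_step; lia || assumption.
  - destruct (continuity_uniform x T Cx ltac:(lra) (eps / 3) ltac:(lra)) as (d1 & Hd1 & Ux).
    destruct (continuity_uniform y T Cy ltac:(lra) (eps / 3) ltac:(lra)) as (d2 & Hd2 & Uy).
    (* With steps of at most [d], the values of [x] and [y] each move by at most [eps / 3], so a
       grid edge changes [h] by at most [2 * eps / 3]. *)
    set (d := Rmin delta (Rmin d1 d2)).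
    assert (0 < d) as Hd by (unfold d; repeat apply Rmin_glb_lt; assumption).
    assert (d <= delta) as Hdd by apply Rmin_l.
    assert (d <= d1 /\ d <= d2) as [Hdd1 Hdd2].
    { pose proof (Rmin_r delta (Rmin d1 d2)); pose proof (Rmin_l d1 d2);
        pose proof (Rmin_r d1 d2); unfold d; lra. }
    destruct (IH eps d Heps Hd) as (N & Q & HQ0 & HQN & HQa & HQd).
    destruct (fine_mesh T d HT Hd) as (M & HM & HMd).
    pose (tm := fun j : nat => T * INR j / INR M).
    pose (h := fun k j => x (tm j) - Rmin (y (Q k i) + x (Q k 0%nat)) p).
    (* The value at [j = 0] is forced: there [h <= 0], but [h] vanishes when the target is [0], and
       the sign test would then return [true]. *)
    pose (s := fun k j => match j with O => false
                          | S _ => if Rle_dec 0 (h k j) then true else false end).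
    assert (tm0 : tm 0%nat = 0) by (unfold tm; simpl; unfold Rdiv; ring).
    assert (tmM : tm M = T).
    { unfold tm; field; apply Rgt_not_eq, lt_0_INR; lia. }
    assert (Htm : forall j, (j <= M)%nat -> 0 <= tm j <= T)
      by (intros; apply mesh_bounds; assumption).
    assert (HQb : forall k, (k <= N)%nat ->
              0 <= x (Q k 0%nat) /\ 0 <= y (Q k i)).
    { intros k Hk; destruct (HQa k Hk) as [Hb _]; split; apply Hpos, Hb; lia. }
    assert (Hm : forall k, (k <= N)%nat -> 0 <= Rmin (y (Q k i) + x (Q k 0%nat)) p <= p).
    { intros k Hk; specialize (HQb k Hk); split; [apply Rmin_glb; lra|apply Rmin_r]. }
    assert (Hfalse : forall k j, (k <= N)%nat -> s k j = false -> h k j <= 0).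
    { intros k [|j] Hk; unfold s.
      - intros _; unfold h; rewrite tm0, x0; specialize (Hm k Hk); lra.
      - destruct (Rle_dec 0 (h k (S j))); [discriminate|lra]. }
    assert (Htrue : forall k j, s k j = true -> 0 <= h k j).
    { intros k [|j]; unfold s; [discriminate|].
      destruct (Rle_dec 0 (h k (S j))); [auto|discriminate]. }
    (* Across a flip [h] passes between nonpositive and nonnegative, so its size is at most its
       variation. *)
    assert (Hflip : forall k j k' j', (k <= N)%nat -> (k' <= N)%nat -> s k j <> s k' j' ->
              Rabs (h k' j' - h k j) <= eps -> Rabs (h k j) <= eps).
    { intros k j k' j' Hk Hk' Hne Hh.
      pose proof (Rabs_le_inv _ _ Hh) as Hh'.
      destruct (s k j) eqn:E, (s k' j') eqn:E'; try congruence;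
        [apply Htrue in E; apply Hfalse in E'|apply Hfalse in E; try apply Htrue in E'];
        try assumption; apply Rabs_le; lra. }
    destruct (strip_walk s N M) as (L & w & w0 & w0M & w0f & wL & wf & wn).
    { reflexivity. }
    { intros k Hk; destruct M as [|M']; [lia|]; unfold s.
      destruct (Rle_dec 0 (h k (S M'))) as [|n]; [reflexivity|].
      exfalso; apply n; unfold h; rewrite tmM, xT; specialize (Hm k Hk); lra. }
    (* The walk selects an old orbit by its first coordinate and appends the mesh point given by its
       second. *)
    exists L, (fun r k => if (k <=? i)%nat then Q (fst (w r)) k else tm (snd (w r))).
    assert (w00 : snd (w 0%nat) = 0%nat).
    { (* Row 0 has target value 0, so its only sign change is at its first edge. *)
      assert (forall j, s 0%nat (S j) = true \/ (M < S j)%nat) as Hs.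
      { intros j; destruct (le_lt_dec (S j) M) as [Hj|]; [left|right; assumption].
        unfold s; destruct (Rle_dec 0 (h 0%nat (S j))) as [|n]; [reflexivity|].
        exfalso; apply n; unfold h; rewrite !HQ0 by lia; rewrite x0, y0.
        rewrite Rmin_left by lra.
        pose proof (Hpos _ (Htm _ Hj)); lra. }
      destruct (snd (w 0%nat)) as [|j]; [reflexivity|].
      exfalso; destruct (Hs j), (Hs (S j)); try lia; congruence. }
    split; [|split; [|split]].
    + intros k Hk; rewrite w0, w00.
      destruct (Nat.leb_spec k i); [apply HQ0; assumption|exact tm0].
    + simpl; rewrite wL; exact HQN.
    + intros r Hr; destruct (wf r Hr) as (Hk & Hj & Hf).
      destruct (HQa _ Hk) as [Hb He].
      split.
      * intros k Hki; destruct (Nat.leb_spec k i); [apply Hb; assumption|apply Htm; assumption].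
      * intros k Hki.
        destruct (Nat.leb_spec k i); [|lia].
        destruct (Nat.leb_spec (S k) i); [apply He; lia|].
        assert (k = i) as -> by lia.
        change (Rabs (h (fst (w r)) (snd (w r))) <= eps).
        (* Along [j] only the value of [x] at the mesh point moves; along [k] only the truncated
           target moves. *)
        destruct Hf as [[HjM Hne]|[HkN Hne]]; eapply Hflip; try exact Hne; try lia.
        -- unfold h.
           match goal with |- Rabs (?a - ?c - (?b - ?c)) <= _ =>
             replace (a - c - (b - c)) with (a - b) by ring end.
           apply Rle_trans with (eps / 3); [|lra].
           apply Ux; [apply Htm; lia|apply Htm; lia|].
           eapply Rle_trans; [apply mesh_step; lia || assumption|lra].
        -- unfold h.
           match goal with |- Rabs (?c - ?a - (?c - ?b)) <= _ =>
             replace (c - a - (c - b)) with (b - a) by ring end.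
           eapply Rle_trans; [apply Rmin_lipschitz|].
           destruct (HQa (S (fst (w r))) ltac:(lia)) as [Hb' _].
           pose proof (Ux (Q (fst (w r)) 0%nat) (Q (S (fst (w r))) 0%nat)
             (Hb 0%nat ltac:(lia)) (Hb' 0%nat ltac:(lia))
             ltac:(rewrite Rabs_minus_sym; eapply Rle_trans; [apply HQd; lia|lra])) as E1.
           pose proof (Uy (Q (fst (w r)) i) (Q (S (fst (w r))) i)
             (Hb i ltac:(lia)) (Hb' i ltac:(lia))
             ltac:(rewrite Rabs_minus_sym; eapply Rle_trans; [apply HQd; lia|lra])) as E2.
           apply Rabs_le_inv in E1, E2; apply Rabs_le; lra.
    + intros r k Hr Hk; destruct (wn r Hr) as (A1 & A2 & B1 & B2).
      destruct (wf r ltac:(lia)) as (K1 & _ & _), (wf (S r) ltac:(lia)) as (K2 & _ & _).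
      apply Rle_trans with d; [|exact Hdd].
      destruct (Nat.leb_spec k i).
      (* The index of the old orbit may stay, advance or go back by one. *)
      * destruct (Nat.eq_dec (fst (w (S r))) (fst (w r))) as [->|].
        { rewrite Rminus_diag, Rabs_R0; lra. }
        destruct (Nat.eq_dec (fst (w (S r))) (S (fst (w r)))) as [E|].
        { rewrite E; apply HQd; lia. }
        assert (fst (w r) = S (fst (w (S r)))) as E by lia.
        rewrite E, Rabs_minus_sym; apply HQd; lia.
      * eapply Rle_trans; [apply mesh_step; assumption|exact HMd].
Qed.

(** A discrete intermediate value argument: along the path the closing defect [g] starts at [- p],
    ends nonnegative because [x T = p] and [y >= 0], and moves by less than [eps] per step. *)
Lemma approx_closed_orbit (x y : R -> R) (T p : R) :
  continuity x -> continuity y -> 0 < T -> 0 < p ->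
  x 0 = 0 -> y 0 = 0 -> x T = p ->
  (forall t, 0 <= t <= T -> 0 <= x t /\ 0 <= y t) ->
  forall i eps, 0 < eps -> exists q : nat -> R,
    approx_orbit x y T p eps i q /\ Rabs (y (q i) + x (q 0%nat) - p) <= eps.
Proof.
  intros Cx Cy HT Hp x0 y0 xT Hpos i eps Heps.
  destruct (continuity_uniform x T Cx ltac:(lra) (eps / 3) ltac:(lra)) as (d1 & Hd1 & Ux).
  destruct (continuity_uniform y T Cy ltac:(lra) (eps / 3) ltac:(lra)) as (d2 & Hd2 & Uy).
  destruct (approx_orbit_path x y T p Cx Cy HT Hp x0 y0 xT Hpos i eps (Rmin d1 d2) Heps
              ltac:(apply Rmin_glb_lt; assumption)) as (N & Q & HQ0 & HQN & HQa & HQd).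
  pose proof (Rmin_l d1 d2) as Hm1; pose proof (Rmin_r d1 d2) as Hm2.
  set (g := fun r => y (Q r i) + x (Q r 0%nat) - p).
  assert (forall r, (r <= N)%nat ->
            g r < 0 \/ exists r', (r' <= N)%nat /\ Rabs (g r') <= eps) as Hind.
  { induction r as [|r IHr]; intros Hr.
    - left; unfold g; rewrite !HQ0, x0, y0 by lia; lra.
    - destruct (IHr ltac:(lia)) as [Hneg|Hex]; [|right; exact Hex].
      destruct (Rlt_le_dec (g (S r)) 0) as [|Hge]; [left; assumption|right].
      exists (S r); split; [exact Hr|].
      destruct (HQa r ltac:(lia)) as [Hb _], (HQa (S r) ltac:(lia)) as [Hb' _].
      pose proof (Ux _ _ (Hb' 0%nat ltac:(lia)) (Hb 0%nat ltac:(lia))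
        (Rle_trans _ _ _ (HQd r 0%nat ltac:(lia) ltac:(lia)) Hm1)) as E1.
      pose proof (Uy _ _ (Hb' i ltac:(lia)) (Hb i ltac:(lia))
        (Rle_trans _ _ _ (HQd r i ltac:(lia) ltac:(lia)) Hm2)) as E2.
      apply Rabs_le_inv in E1, E2; unfold g in *; apply Rabs_le; lra. }
  destruct (Hind N (le_n N)) as [Hneg|(r & Hr & Hg)].
  - exfalso; unfold g in Hneg; rewrite HQN, xT in Hneg.
    destruct (HQa N (le_n N)) as [Hb _]; pose proof (Hpos _ (Hb i (le_n i))); lra.
  - exists (Q r); split; [apply HQa; exact Hr|exact Hg].
Qed.

(** * Compactness and the passage to exact orbits *)

(** Extractions are recorded by [n <= phi n] instead of strict monotonicity; this is stable under
    composition and preserves limits. *)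
Lemma bounded_subsequence (u : nat -> R) (T : R) : (forall n, 0 <= u n <= T) ->
  exists (l : R) (phi : nat -> nat),
    0 <= l <= T /\ (forall n, (n <= phi n)%nat) /\ Un_cv (fun n => u (phi n)) l.
Proof.
  intros Hu.
  destruct (Bolzano_Weierstrass u (fun t => 0 <= t <= T) (compact_P3 0 T) Hu) as [l Hl].
  assert (forall n, exists m, (n <= m)%nat /\ Rabs (u m - l) < / INR (S n)) as Hm.
  { intros n.
    assert (0 < / INR (S n)) as Hpos by (apply Rinv_0_lt_compat, lt_0_INR; lia).
    apply (Hl (disc l (mkposreal _ Hpos)) n).
    exists (mkposreal _ Hpos); intros t Ht; exact Ht. }
  destruct (functional_choice _ Hm) as [phi Hphi].
  assert (Un_cv (fun n => u (phi n)) l) as Hcv.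
  { intros eps Heps; destruct (archimed_cor1 eps Heps) as (N & HN & HN0).
    exists N; intros n Hn; unfold Rdist.
    eapply Rlt_trans; [apply Hphi|].
    eapply Rle_lt_trans; [|exact HN].
    apply Rinv_le_contravar; [apply lt_0_INR; lia|apply le_INR; lia]. }
  exists l, phi; split; [|split; [intros n; apply Hphi|exact Hcv]].
  split.
  - apply Rnot_lt_le; intros Hneg.
    destruct (Hcv (- l) ltac:(lra)) as [N HN]; specialize (HN N (le_n N)).
    unfold Rdist in HN; apply Rabs_def2 in HN; specialize (Hu (phi N)); lra.
  - apply Rnot_lt_le; intros Hneg.
    destruct (Hcv (l - T) ltac:(lra)) as [N HN]; specialize (HN N (le_n N)).
    unfold Rdist in HN; apply Rabs_def2 in HN; specialize (Hu (phi N)); lra.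
Qed.

Lemma bounded_joint_subsequence (F : nat -> nat -> R) (T : R) (i : nat) :
  (forall n k, (k <= i)%nat -> 0 <= F n k <= T) ->
  exists (l : nat -> R) (phi : nat -> nat),
    (forall n, (n <= phi n)%nat) /\
    forall k, (k <= i)%nat -> 0 <= l k <= T /\ Un_cv (fun n => F (phi n) k) (l k).
Proof.
  revert F; induction i as [|i IH]; intros F HF.
  - destruct (bounded_subsequence (fun n => F n 0%nat) T) as (l & phi & Hl & Hphi & Hcv).
    { intros n; apply HF; lia. }
    exists (fun _ => l), phi; split; [exact Hphi|].
    intros k Hk; assert (k = 0%nat) as -> by lia; auto.
  - destruct (bounded_subsequence (fun n => F n (S i)) T) as (l & phi & Hl & Hphi & Hcv).
    { intros n; apply HF; lia. }
    destruct (IH (fun n => F (phi n))) as (l' & psi & Hpsi & Hcv').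
    { intros n k Hk; apply HF; lia. }
    (* The last coordinate is made convergent first; the further extraction [psi] for the others
       keeps its limit. *)
    exists (fun k => if (k <=? i)%nat then l' k else l), (fun n => phi (psi n)).
    split; [intros n; eapply Nat.le_trans; [apply Hpsi|apply Hphi]|].
    intros k Hk; destruct (Nat.leb_spec k i); [apply Hcv'; assumption|].
    assert (k = S i) as -> by lia.
    split; [exact Hl|].
    intros eps Heps; destruct (Hcv eps Heps) as [N HN].
    exists N; intros n Hn; apply HN; specialize (Hpsi n); lia.
Qed.

Lemma Rabs_le_all_eq0 a : (forall eps, 0 < eps -> Rabs a <= eps) -> a = 0.
Proof.
  intros H; destruct (Req_dec a 0) as [|Hne]; [assumption|].
  pose proof (Rabs_pos_lt a Hne); specialize (H (Rabs a / 2) ltac:(lra)); lra.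
Qed.

(** A limit point of approximate closed orbits with errors [/ INR (S n)]; all relations are closed
    conditions on finitely many parameters. *)
Lemma closed_orbit (x y : R -> R) (T p : R) :
  continuity x -> continuity y -> 0 < T -> 0 < p ->
  x 0 = 0 -> y 0 = 0 -> x T = p ->
  (forall t, 0 <= t <= T -> 0 <= x t /\ 0 <= y t) ->
  forall i, exists q : nat -> R,
    (forall k, (k <= i)%nat -> 0 <= q k <= T) /\
    (forall k, (k < i)%nat -> x (q (S k)) = Rmin (y (q k) + x (q 0%nat)) p) /\
    y (q i) + x (q 0%nat) = p.
Proof.
  intros Cx Cy HT Hp x0 y0 xT Hpos i.
  assert (forall n : nat, exists q : nat -> R,
    approx_orbit x y T p (/ INR (S n)) i q /\
    Rabs (y (q i) + x (q 0%nat) - p) <= / INR (S n)) as Hn.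
  { intros n; apply approx_closed_orbit; try assumption.
    apply Rinv_0_lt_compat, lt_0_INR; lia. }
  destruct (functional_choice _ Hn) as [F HF].
  destruct (bounded_joint_subsequence F T i) as (q & phi & Hphi & Hq).
  { intros n k Hk; apply (HF n); exact Hk. }
  assert (forall f k eps, continuity f -> (k <= i)%nat -> 0 < eps ->
            exists N, forall n, (n >= N)%nat -> Rabs (f (F (phi n) k) - f (q k)) < eps) as Hlim.
  { intros f k eps Cf Hk Heps.
    exact (continuity_seq f _ _ (Cf (q k)) (proj2 (Hq k Hk)) eps Heps). }
  assert (forall eps, 0 < eps -> exists N, forall n, (n >= N)%nat -> / INR (S (phi n)) <= eps)
    as Hinv.
  { intros eps Heps; destruct (archimed_cor1 eps Heps) as (N & HN & HN0).
    exists N; intros n Hn'; left; eapply Rle_lt_trans; [|exact HN].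
    specialize (Hphi n).
    apply Rinv_le_contravar; [apply lt_0_INR; lia|apply le_INR; lia]. }
  exists q; split; [intros k Hk; apply Hq; exact Hk|split].
  (* Four errors of [eps / 4]: the defect of the approximate orbit, and the convergence of [x] at
     [S k], [y] at [k] and [x] at [0]. *)
  - intros k Hk; apply Rminus_diag_uniq, Rabs_le_all_eq0; intros eps Heps.
    destruct (Hinv (eps / 4) ltac:(lra)) as [N0 H0].
    destruct (Hlim x (S k) (eps / 4) Cx ltac:(lia) ltac:(lra)) as [N1 H1].
    destruct (Hlim y k (eps / 4) Cy ltac:(lia) ltac:(lra)) as [N2 H2].
    destruct (Hlim x 0%nat (eps / 4) Cx ltac:(lia) ltac:(lra)) as [N3 H3].
    set (n := (N0 + N1 + N2 + N3)%nat).
    specialize (H0 n ltac:(lia)); specialize (H1 n ltac:(lia));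
      specialize (H2 n ltac:(lia)); specialize (H3 n ltac:(lia)).
    destruct (HF (phi n)) as [[_ Ho] _]; specialize (Ho k Hk).
    pose proof (Rmin_lipschitz (y (F (phi n) k) + x (F (phi n) 0%nat))
                  (y (q k) + x (q 0%nat)) p) as Hlip.
    assert (Rabs (y (F (phi n) k) + x (F (phi n) 0%nat) - (y (q k) + x (q 0%nat)))
              <= eps / 2) as Hs.
    { apply Rabs_def2 in H2, H3; apply Rabs_le; lra. }
    apply Rabs_def2 in H1; apply Rabs_le_inv in Ho.
    pose proof (Rabs_le_inv _ _ (Rle_trans _ _ _ Hlip Hs)).
    apply Rabs_le; lra.
  - apply Rminus_diag_uniq, Rabs_le_all_eq0; intros eps Heps.
    destruct (Hinv (eps / 3) ltac:(lra)) as [N0 H0].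
    destruct (Hlim y i (eps / 3) Cy ltac:(lia) ltac:(lra)) as [N1 H1].
    destruct (Hlim x 0%nat (eps / 3) Cx ltac:(lia) ltac:(lra)) as [N2 H2].
    set (n := (N0 + N1 + N2)%nat).
    specialize (H0 n ltac:(lia)); specialize (H1 n ltac:(lia)); specialize (H2 n ltac:(lia)).
    destruct (HF (phi n)) as [_ Hc].
    apply Rabs_def2 in H1, H2; apply Rabs_le_inv in Hc; apply Rabs_le; lra.
Qed.

(** * Balanced chains and the cyclic shift *)

(** The end point is left free so that chains can be prolonged along the diagonal, and the point set
    is left free so that the coordinates can be exchanged. *)
Definition balanced_chain (C : R * R -> Prop) (n : nat) (P : R * R) : Prop :=
  exists A : nat -> R * R,
    (forall i, (i <= S n)%nat -> C (A i)) /\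
    A 0%nat = (0, 0) /\ A (S n) = P /\
    (forall i, (i <= n)%nat ->
       0 < pi1 (vec (A i) (A (S i))) /\ 0 < pi2 (vec (A i) (A (S i)))) /\
    exists sigma : nat -> nat, is_perm_upto n sigma /\
      forall i, (i <= n)%nat ->
        pi1 (vec (A i) (A (S i))) = pi2 (vec (A (sigma i)) (A (S (sigma i)))).

Lemma balanced_chain_square C p : 0 < p -> C (0, 0) -> C (p, p) -> balanced_chain C 0 (p, p).
Proof.
  intros Hp C0 Cp.
  exists (fun i => match i with O => (0, 0) | S _ => (p, p) end).
  split; [intros [|i] _; assumption|].
  split; [reflexivity|]; split; [reflexivity|]; split.
  - intros i Hi; assert (i = 0%nat) as -> by lia; unfold pi1, pi2, vec; simpl; lra.
  - exists (fun i => i); split; [split; auto|].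
    intros i Hi; assert (i = 0%nat) as -> by lia; unfold pi1, pi2, vec; simpl; lra.
Qed.

(** The added step has both increments equal to [q - p], so the permutation is prolonged by the
    fixed point [S n]. *)
Lemma balanced_chain_extend C n p q : p < q -> C (q, q) ->
  balanced_chain C n (p, p) -> balanced_chain C (S n) (q, q).
Proof.
  intros Hpq Cq (A & HC & A0 & An & Hpos & sigma & [Hs1 Hs2] & Heq).
  exists (fun i => if (i <=? S n)%nat then A i else (q, q)).
  split; [|split; [|split; [|split]]].
  - intros i Hi; destruct (Nat.leb_spec i (S n)); auto.
  - exact A0.
  - destruct (Nat.leb_spec (S (S n)) (S n)); [lia|reflexivity].
  - intros i Hi.
    destruct (Nat.leb_spec i (S n)); [|lia].
    destruct (Nat.leb_spec (S i) (S n)); [apply Hpos; lia|].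
    assert (i = S n) as -> by lia; rewrite An; unfold pi1, pi2, vec; simpl; lra.
  - exists (fun i => if (i <=? n)%nat then sigma i else S n); split; [split|].
    + intros i Hi; destruct (Nat.leb_spec i n); [specialize (Hs1 i); lia|lia].
    + intros i j Hi Hj; destruct (Nat.leb_spec i n), (Nat.leb_spec j n); intros E.
      * apply Hs2; assumption.
      * specialize (Hs1 i); lia.
      * specialize (Hs1 j); lia.
      * lia.
    + intros i Hi.
      destruct (Nat.leb_spec i (S n)); [|lia].
      destruct (Nat.leb_spec (S i) (S n)), (Nat.leb_spec i n); try lia.
      * pose proof (Hs1 i ltac:(lia)).
        destruct (Nat.leb_spec (sigma i) (S n)), (Nat.leb_spec (S (sigma i)) (S n)); try lia.
        apply Heq; lia.
      * assert (i = S n) as -> by lia.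
        destruct (Nat.leb_spec (S n) (S n)), (Nat.leb_spec (S (S n)) (S n)); try lia.
        rewrite An; unfold pi1, pi2, vec; simpl; lra.
Qed.

Lemma is_perm_upto_inverse n sigma : is_perm_upto n sigma ->
  exists tau, is_perm_upto n tau /\ forall i, (i <= n)%nat -> sigma (tau i) = i.
Proof.
  intros [H1 H2].
  assert (bFun (S n) sigma) as HF by (intros i Hi; specialize (H1 i); lia).
  destruct (bSurjective_bBijective HF) as (tau & Ht & Hst).
  { apply bInjective_bSurjective; [exact HF|].
    intros i j Hi Hj; apply H2; lia. }
  exists tau; split; [split|].
  - intros i Hi; specialize (Ht i); lia.
  - intros i j Hi Hj E; rewrite <- (proj2 (Hst i ltac:(lia))), <- (proj2 (Hst j ltac:(lia))).
    now rewrite E.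
  - intros i Hi; apply Hst; lia.
Qed.

Definition swap (P : R * R) : R * R := (snd P, fst P).

(** Exchanging the coordinates reads the matching backwards, so the inverse permutation serves. *)
Lemma balanced_chain_swap C n p :
  balanced_chain (fun P => C (swap P)) n (p, p) -> balanced_chain C n (p, p).
Proof.
  intros (A & HC & A0 & An & Hpos & sigma & Hs & Heq).
  destruct (is_perm_upto_inverse n sigma Hs) as (tau & Ht & Hst).
  exists (fun i => swap (A i)).
  split; [exact HC|]; split; [now rewrite A0|]; split; [now rewrite An|]; split.
  - intros i Hi; destruct (Hpos i Hi); split; assumption.
  - exists tau; split; [exact Ht|].
    intros i Hi; pose proof (Heq (tau i) (proj1 Ht i Hi)) as E; rewrite (Hst i Hi) in E.
    symmetry; exact E.
Qed.

(* The cyclic shift: with [c] the first horizontal increment, the orbit relation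
   [fst (A (S k)) = snd (A k) + c] makes each horizontal increment equal to the
   preceding vertical one, and it increases because the arc lies above the diagonal. *)
Lemma balanced_chain_arc (C : R * R -> Prop) (x y : R -> R) (T p : R) (n : nat) :
  continuity x -> continuity y -> 0 < T ->
  x 0 = 0 -> y 0 = 0 -> x T = p -> y T = p ->
  (forall t, 0 < t <= T -> 0 < x t) ->
  (forall t, 0 <= t <= T -> x t <= y t) ->
  (forall t, 0 <= t <= T -> C (x t, y t)) ->
  balanced_chain C n (p, p).
Proof.
  intros Cx Cy HT x0 y0 xT yT Hpos Hxy HC.
  assert (0 < p) as Hp by (rewrite <- xT; apply Hpos; lra).
  assert (C (0, 0)) as C00 by (pose proof (HC 0 ltac:(lra)) as HCt; rewrite x0, y0 in HCt; exact HCt).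
  assert (C (p, p)) as Cpp by (pose proof (HC T ltac:(lra)) as HCt; rewrite xT, yT in HCt; exact HCt).
  (* For [n = S i] the intermediate points of the chain are the [S i] orbit points [q 0], ...,
     [q i]. *)
  destruct n as [|i]; [apply balanced_chain_square; assumption|].
  assert (forall t, 0 <= t <= T -> 0 <= x t) as Hx.
  { intros t Ht; destruct (Req_dec t 0) as [->|]; [lra|left; apply Hpos; lra]. }
  destruct (closed_orbit x y T p Cx Cy HT Hp x0 y0 xT) with (i := i) as (q & Hq & Horb & Hend).
  { intros t Ht; specialize (Hx t Ht); specialize (Hxy t Ht); lra. }
  set (c := x (q 0%nat)) in *.
  (* If [c = 0], then [q 0 = 0], as [x] vanishes only at [0]; the relation keeps the whole orbit at
     [0], against the closing equation. *)
  assert (0 < c) as Hc.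
  { destruct (Hx (q 0%nat) (Hq 0%nat ltac:(lia))) as [|E]; [assumption|exfalso].
    assert (forall t, 0 <= t <= T -> x t = 0 -> t = 0) as Hz.
    { intros t Ht Ez; destruct (Req_dec t 0) as [|Hne]; [assumption|].
      specialize (Hpos t ltac:(lra)); lra. }
    assert (forall k, (k <= i)%nat -> q k = 0) as Hq0.
    { induction k as [|k IHk]; intros Hk.
      - apply Hz; [apply Hq; lia|symmetry; exact E].
      - apply Hz; [apply Hq; lia|].
        rewrite Horb by lia; rewrite IHk, y0 by lia.
        unfold c; rewrite <- E, Rmin_left; lra. }
    rewrite Hq0, y0 in Hend by lia; unfold c in Hend; lra. }
  (* Backward from the end, [x <= y] and [c > 0] keep every orbit point strictly below [p], so the
     truncation by [Rmin] is never active. *)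
  assert (forall d k, (k + d = i)%nat -> x (q k) < p) as Hlt.
  { induction d as [|d IHd]; intros k Hk.
    - assert (k = i) as -> by lia.
      specialize (Hxy (q i) (Hq i ltac:(lia))); lra.
    - specialize (IHd (S k) ltac:(lia)); rewrite Horb in IHd by lia.
      specialize (Hxy (q k) (Hq k ltac:(lia))).
      unfold Rmin in IHd; destruct Rle_dec; lra. }
  set (A := fun k => match k with O => (0, 0)
                     | S k => if (k <=? i)%nat then (x (q k), y (q k)) else (p, p) end).
  assert (Alast : A (S (S i)) = (p, p)).
  { unfold A; destruct (Nat.leb_spec (S i) i); [lia|reflexivity]. }
  assert (Astep : forall k, (k <= S i)%nat -> fst (A (S k)) = snd (A k) + c).
  { intros [|k] Hk; unfold A.
    - simpl; fold c; ring.
    - destruct (Nat.leb_spec k i); [|lia].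
      destruct (Nat.leb_spec (S k) i); simpl.
      + specialize (Hlt (i - S k)%nat (S k) ltac:(lia)).
        rewrite Horb in * by lia; unfold Rmin in *; destruct Rle_dec; lra.
      + assert (k = i) as -> by lia; lra. }
  assert (Adiag : forall k, fst (A k) <= snd (A k)).
  { intros [|k]; unfold A; [simpl; lra|].
    destruct (Nat.leb_spec k i); simpl; [apply Hxy, Hq; assumption|lra]. }
  assert (Au : forall k, (k <= S i)%nat -> 0 < fst (A (S k)) - fst (A k)).
  { intros k Hk; rewrite Astep by exact Hk; specialize (Adiag k); lra. }
  assert (Av : forall k, (k <= i)%nat ->
            snd (A (S k)) - snd (A k) = fst (A (S (S k))) - fst (A (S k))).
  { intros k Hk; rewrite (Astep (S k)), (Astep k) by lia; ring. }
  assert (Avlast : snd (A (S (S i))) - snd (A (S i)) = c).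
  { pose proof (Astep (S i) (le_n _)) as E; rewrite Alast in *; simpl in *; lra. }
  exists A; split; [|split; [|split; [|split]]].
  - intros [|k] Hk; unfold A; [exact C00|].
    destruct (Nat.leb_spec k i); [apply HC, Hq; assumption|exact Cpp].
  - reflexivity.
  - exact Alast.
  - intros k Hk; unfold pi1, pi2, vec; cbn [fst snd]; split; [apply Au; exact Hk|].
    destruct (Nat.eq_dec k (S i)) as [->|]; [rewrite Avlast; exact Hc|].
    rewrite Av by lia; apply Au; lia.
  (* Horizontal increment [S k] is vertical increment [k]; the first horizontal one, [c], is the
     last vertical one, with index [S i]. *)
  - exists (fun k => match k with O => S i | S k => k end); split; [split|].
    + intros [|k]; lia.
    + intros [|k] [|l]; lia.
    + intros [|k] Hk; unfold pi1, pi2, vec; cbn [fst snd].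
      * rewrite Avlast, Astep by lia; simpl; ring.
      * rewrite Av by lia; reflexivity.
Qed.

(** * From arcs above the diagonal to the whole curve *)

(** [T] is the supremum of the times up to which [x <= y] persists. A strict inequality at [T < 1]
    would persist beyond [T]; at [T = 1] equality is given. Earlier contacts with the diagonal are
    allowed. *)
Lemma first_diagonal_return (x y : R -> R) (e : R) :
  continuity x -> continuity y -> 0 < e <= 1 -> x 1 = y 1 ->
  (forall t, 0 <= t <= e -> x t <= y t) ->
  exists T, 0 < T <= 1 /\ x T = y T /\ forall t, 0 <= t <= T -> x t <= y t.
Proof.
  intros Cx Cy He H1 Hxy.
  set (E := fun t => t <= 1 /\ forall s, 0 <= s <= t -> x s <= y s).
  destruct (completeness E) as [T [Tub Tlub]].
  { exists 1; intros t [Ht _]; exact Ht. }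
  { exists e; split; [lra|exact Hxy]. }
  assert (e <= T) as HeT by (apply Tub; split; [lra|exact Hxy]).
  assert (T <= 1) as HT1 by (apply Tlub; intros t [Ht _]; exact Ht).
  assert (continuity (fun t => y t - x t)) as Cf by (apply continuity_minus; assumption).
  assert (Hbelow : forall t, 0 <= t < T -> x t <= y t).
  { intros t Ht; apply Rnot_lt_le; intros Hlt.
    assert (T <= t); [|lra].
    apply Tlub; intros s [_ Hs]; apply Rnot_lt_le; intros Hts.
    specialize (Hs t ltac:(lra)); lra. }
  assert (Hnear : forall r, 0 < r -> exists d, 0 < d /\ forall t, Rabs (t - T) < d ->
            Rabs (y t - x t - (y T - x T)) < r).
  { intros r Hr; destruct (Cf T r Hr) as (d & Hd & Hlim).
    exists d; split; [exact Hd|].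
    intros t Ht; destruct (Req_dec t T) as [->|Hne].
    - rewrite Rminus_diag, Rabs_R0; exact Hr.
    - apply Hlim; split; [split; [exact I|auto]|exact Ht]. }
  assert (HxT : x T <= y T).
  { apply Rnot_lt_le; intros Hlt.
    destruct (Hnear (x T - y T) ltac:(lra)) as (d & Hd & Hlim).
    (* A time just before [T], where [y < x] would still hold by continuity. *)
    set (m := Rmax 0 (T - d / 2)).
    assert (0 <= m < T) as Hm by (unfold m, Rmax; destruct Rle_dec; lra).
    assert (T - d / 2 <= m) by apply Rmax_r.
    specialize (Hlim m ltac:(apply Rabs_def1; lra)); apply Rabs_def2 in Hlim.
    specialize (Hbelow m Hm); lra. }
  assert (Hall : forall t, 0 <= t <= T -> x t <= y t).
  { intros t Ht; destruct (Req_dec t T) as [->|]; [exact HxT|apply Hbelow; lra]. }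
  exists T; split; [lra|]; split; [|exact Hall].
  destruct HxT as [Hlt|]; [exfalso|assumption].
  destruct (Req_dec T 1) as [->|]; [lra|].
  destruct (Hnear (y T - x T) ltac:(lra)) as (d & Hd & Hlim).
  (* A time just after [T] that would still belong to [E]. *)
  set (m := Rmin 1 (T + d / 2)).
  assert (T < m <= 1) as Hm by (unfold m, Rmin; destruct Rle_dec; lra).
  assert (m <= T + d / 2) by apply Rmin_r.
  assert (m <= T); [|lra].
  apply Tub; split; [lra|].
  intros s Hs; destruct (Rle_lt_dec s T); [apply Hall; lra|].
  specialize (Hlim s ltac:(apply Rabs_def1; lra)); apply Rabs_def2 in Hlim; lra.
Qed.

(** When the return time is less than [1], the arc takes all increments but one, left for the square
    step to [(1, 1)]; for [n = 0] that step starts at the origin. *)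
Lemma balanced_chain_above (C : R * R -> Prop) (x y : R -> R) (e : R) (n : nat) :
  continuity x -> continuity y -> 0 < e <= 1 ->
  x 0 = 0 -> y 0 = 0 -> x 1 = 1 -> y 1 = 1 ->
  (forall t, 0 < t < 1 -> 0 < x t < 1) ->
  (forall t, 0 <= t <= 1 -> C (x t, y t)) ->
  (forall t, 0 <= t <= e -> x t <= y t) ->
  balanced_chain C n (1, 1).
Proof.
  intros Cx Cy He x0 y0 x1 y1 Hin HC Hxy.
  destruct (first_diagonal_return x y e Cx Cy He ltac:(lra) Hxy) as (T & HT & HTd & HTxy).
  assert (Harc : forall m, balanced_chain C m (x T, x T)).
  { intros m; apply (balanced_chain_arc C x y T); try assumption; try lra.
    - intros t Ht; destruct (Req_dec t 1) as [->|]; [lra|apply Hin; lra].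
    - intros t Ht; apply HC; lra. }
  destruct (Req_dec T 1) as [->|HT1]; [rewrite x1 in Harc; apply Harc|].
  assert (C (1, 1)) by (pose proof (HC 1 ltac:(lra)) as HCt; rewrite x1, y1 in HCt; exact HCt).
  destruct n as [|n].
  - apply balanced_chain_square; [lra| |assumption].
    pose proof (HC 0 ltac:(lra)) as HCt; rewrite x0, y0 in HCt; exact HCt.
  - apply balanced_chain_extend with (x T); [apply Hin; lra|assumption|apply Harc].
Qed.

(** The points are chosen from the last one down: the end point [q] becomes the bound for the
    shorter chain, hence the bound [b] is quantified inside the induction. *)
Lemma balanced_chain_diagonal (C : R * R -> Prop) (n : nat) :
  C (0, 0) -> (forall b, 0 < b -> exists p, 0 < p < b /\ C (p, p)) ->
  forall b, 0 < b -> exists p, 0 < p < b /\ balanced_chain C n (p, p).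
Proof.
  intros C0 Hd; induction n as [|n IH]; intros b Hb.
  - destruct (Hd b Hb) as (p & Hp & Cp).
    exists p; split; [exact Hp|apply balanced_chain_square; tauto].
  - destruct (Hd b Hb) as (q & Hq & Cq).
    destruct (IH q ltac:(lra)) as (p & Hp & Hch).
    exists q; split; [exact Hq|].
    apply balanced_chain_extend with p; [lra|exact Cq|exact Hch].
Qed.

Lemma balanced_chain_continuous (C : R * R -> Prop) (x y : R -> R) (n : nat) :
  continuity x -> continuity y ->
  x 0 = 0 -> y 0 = 0 -> x 1 = 1 -> y 1 = 1 ->
  (forall t, 0 < t < 1 -> 0 < x t < 1 /\ 0 < y t < 1) ->
  (forall t, 0 <= t <= 1 -> C (x t, y t)) ->
  balanced_chain C n (1, 1).
Proof.
  intros Cx Cy x0 y0 x1 y1 Hin HC.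
  destruct (classic (exists e, 0 < e <= 1 /\ forall t, 0 <= t <= e -> x t <= y t))
    as [(e & He & Hxy)|Hno1].
  { apply (balanced_chain_above C x y e); try assumption; intros t Ht; apply Hin, Ht. }
  destruct (classic (exists e, 0 < e <= 1 /\ forall t, 0 <= t <= e -> y t <= x t))
    as [(e & He & Hxy)|Hno2].
  { apply balanced_chain_swap, (balanced_chain_above _ y x e); try assumption.
    intros t Ht; apply Hin, Ht. }
  assert (C (0, 0)) as C0 by (pose proof (HC 0 ltac:(lra)) as HCt; rewrite x0, y0 in HCt; exact HCt).
  assert (C (1, 1)) as C1 by (pose proof (HC 1 ltac:(lra)) as HCt; rewrite x1, y1 in HCt; exact HCt).
  assert (continuity (fun t => y t - x t)) as Cf by (apply continuity_minus; assumption).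
  assert (Hzero : forall e, 0 < e <= 1 -> exists t, 0 < t <= e /\ x t = y t).
  { intros e He.
    (* Failure of each weak inequality on [[0, e]] gives a point of each strict sign of [y - x]; a
       zero lies between them. *)
    assert (exists a, 0 < a <= e /\ y a < x a) as (a & Ha & Hya).
    { apply NNPP; intros Hn; apply Hno1; exists e; split; [exact He|].
      intros t Ht; apply Rnot_lt_le; intros Hlt; apply Hn; exists t.
      split; [|exact Hlt]; destruct (Req_dec t 0) as [->|]; lra. }
    assert (exists b, 0 < b <= e /\ x b < y b) as (b & Hb & Hyb).
    { apply NNPP; intros Hn; apply Hno2; exists e; split; [exact He|].
      intros t Ht; apply Rnot_lt_le; intros Hlt; apply Hn; exists t.
      split; [|exact Hlt]; destruct (Req_dec t 0) as [->|]; lra. }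
    destruct (Rle_dec a b).
    - destruct (IVT_cor (fun t => y t - x t) a b Cf) as (t & Ht & Et); [lra|nra|].
      exists t; split; lra.
    - destruct (IVT_cor (fun t => y t - x t) b a Cf) as (t & Ht & Et); [lra|nra|].
      exists t; split; lra. }
  assert (Hdiag : forall b, 0 < b -> exists p, 0 < p < b /\ C (p, p)).
  { intros b Hb; destruct (Cx 0 b Hb) as (d & Hd & Hlim).
    (* The bound [1 / 2] keeps [t] inside [(0, 1)], so that [x t > 0]; the bound [d / 2] makes
       [x t < b]. *)
    destruct (Hzero (Rmin (1 / 2) (d / 2))) as (t & Ht & Et).
    { split; [apply Rmin_glb_lt; lra|]. pose proof (Rmin_l (1 / 2) (d / 2)); lra. }
    pose proof (Rmin_l (1 / 2) (d / 2)); pose proof (Rmin_r (1 / 2) (d / 2)).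
    assert (Rabs (x t - x 0) < b) as Hxt.
    { apply Hlim; split; [split; [exact I|lra]|].
      simpl; unfold Rdist; apply Rabs_def1; lra. }
    rewrite x0 in Hxt; apply Rabs_def2 in Hxt.
    exists (x t); split; [split; [apply Hin; lra|lra]|].
    rewrite Et at 2; apply HC; lra. }
  destruct n as [|n]; [apply balanced_chain_square; lra || assumption|].
  destruct (balanced_chain_diagonal C n C0 Hdiag 1 ltac:(lra)) as (p & Hp & Hch).
  apply balanced_chain_extend with p; [lra|exact C1|exact Hch].
Qed.

(** * Extension of the curve to the whole line *)

(** Composition with this 1-Lipschitz retraction turns continuity relative to [[0, 1]] into
    [continuity] on all of [R]. *)
Definition clamp (t : R) : R := Rmax 0 (Rmin 1 t).

Lemma clamp_bounds t : 0 <= clamp t <= 1.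
Proof. unfold clamp, Rmax, Rmin; repeat destruct Rle_dec; lra. Qed.

Lemma clamp_id t : 0 <= t <= 1 -> clamp t = t.
Proof. intros; unfold clamp, Rmax, Rmin; repeat destruct Rle_dec; lra. Qed.

Lemma clamp_lipschitz s t : Rabs (clamp s - clamp t) <= Rabs (s - t).
Proof.
  unfold clamp, Rmax, Rmin; repeat destruct Rle_dec; unfold Rabs;
    repeat destruct Rcase_abs; lra.
Qed.

Lemma continuity_clamp (g : R -> R * R) : continuous_on_01 g ->
  continuity (fun t => fst (g (clamp t))) /\ continuity (fun t => snd (g (clamp t))).
Proof.
  intros Hg; split; intros t eps Heps;
    destruct (Hg (clamp t) (clamp_bounds t) eps Heps) as (d & Hd & H);
    exists d; (split; [exact Hd|]); intros s [_ Hs];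
    apply (H (clamp s) (clamp_bounds s));
    exact (Rle_lt_trans _ _ _ (clamp_lipschitz s t) Hs).
Qed.

Theorem theorem1 (gamma : R -> R * R) :
  continuous_on_01 gamma ->
  (forall t, 0 <= t <= 1 -> 0 <= fst (gamma t) <= 1 /\ 0 <= snd (gamma t) <= 1) ->
  gamma 0 = (0, 0) ->
  gamma 1 = (1, 1) ->
  (forall t, 0 < t < 1 -> 0 < fst (gamma t) < 1 /\ 0 < snd (gamma t) < 1) ->
  forall n : nat, exists A : nat -> R * R,
    (forall i, (i <= S n)%nat -> exists t, 0 <= t <= 1 /\ A i = gamma t) /\
    A 0%nat = (0, 0) /\ A (S n) = (1, 1) /\
    (forall i, (i <= n)%nat ->
       0 < pi1 (vec (A i) (A (S i))) /\ 0 < pi2 (vec (A i) (A (S i)))) /\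
    exists sigma : nat -> nat, is_perm_upto n sigma /\
      forall i, (i <= n)%nat ->
        pi1 (vec (A i) (A (S i))) = pi2 (vec (A (sigma i)) (A (S (sigma i)))).
Proof.
  intros Hcont _ g0 g1 Hin n.
  destruct (continuity_clamp gamma Hcont) as [Cx Cy].
  assert (c0 : clamp 0 = 0) by (apply clamp_id; lra).
  assert (c1 : clamp 1 = 1) by (apply clamp_id; lra).
  apply (balanced_chain_continuous (fun P => exists t, 0 <= t <= 1 /\ P = gamma t)
           _ _ n Cx Cy); rewrite ?c0, ?c1, ?g0, ?g1; try reflexivity.
  - intros t Ht; rewrite clamp_id by lra; apply Hin, Ht.
  - intros t Ht; exists t; split; [exact Ht|].
    rewrite clamp_id by exact Ht; symmetry; apply surjective_pairing.
Qed.
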